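(* There is a positive constant $\kappa$ such that for all sufficiently large integers $n$, $$D'(n)\le\frac12-\frac{\kappa}{(\log\log n)^{1-\frac{\mathrm{e}}{2}\log 2}(\log\log\log n)^{1/2}}.$$
   Context: For a positive integer $n$ and subsets $\mathcal{A},\mathcal{B}$ of $\mathbb{Z}/n\mathbb{Z}$, $\mathcal{A}+\mathcal{B}=\{a+b: a\in\mathcal{A}, b\in\mathcal{B}\}$ and $\mathcal{A}\cdot\mathcal{B}=\{ab: a\in\mathcal{A}, b\in\mathcal{B}\}$ (when $\mathcal{A}=\mathcal{B}$ the two elements are allowed to be equal). A subset $\mathcal{A}\subset\mathbb{Z}/n\mathbb{Z}$ is sum-free if $\mathcal{A}\cap(\mathcal{A}+\mathcal{A})=\emptyset$, and product-free if $\mathcal{A}\cap(\mathcal{A}\cdot\mathcal{A})=\emptyset$. Set $D(\mathcal{A})=|\mathcal{A}|/n$, and $$D'(n)=\max\{D(\mathcal{A}): \mathcal{A}\text{ is a sum-free, product-free subset of }\mathbb{Z}/n\mathbb{Z}\}.$$ Here $\log$ is the natural logarithm and $\mathrm{e}$ is its base. *)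

(* Defs.v *)
From mathcomp Require Import all_boot all_order all_algebra.
From mathcomp Require Import all_classical all_reals all_analysis.

Set Implicit Arguments.
Unset Strict Implicit.
Unset Printing Implicit Defensive.

Import Order.TTheory GRing.Theory Num.Theory.

Local Open Scope ring_scope.

(* ['Z_n] is the ring of integers modulo n only for 1 < n ('Z_0 and 'Z_1 are
   convertible to 'Z_2): the notions below are meaningful only for 1 < n. *)

Definition sumset (n : nat) (A B : {set 'Z_n}) : {set 'Z_n} :=
  [set a + b | a in A, b in B]%SET.

Definition prodset (n : nat) (A B : {set 'Z_n}) : {set 'Z_n} :=
  [set a * b | a in A, b in B]%SET.

Definition sum_free (n : nat) (A : {set 'Z_n}) : bool :=
  A :&: sumset A A == finset.set0.

Definition product_free (n : nat) (A : {set 'Z_n}) : bool :=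
  A :&: prodset A A == finset.set0.

Definition density (R : realType) (n : nat) (A : {set 'Z_n}) : R :=
  #|A|%:R / n%:R.

(* The default value 0 is the density of the empty set, which is sum-free and
   product-free, so this is the maximum of a nonempty finite family. *)
Definition Dprime (R : realType) (n : nat) : R :=
  \big[Num.max/0]_(A : {set 'Z_n} | sum_free A && product_free A) density R A.

(* Main.v *)
Require Import Defs.
From mathcomp Require Import all_boot all_order all_algebra.
From mathcomp Require Import all_classical all_reals all_analysis.
From mathcomp Require Import zify ring lra.

Set Implicit Arguments.
Unset Strict Implicit.
Unset Printing Implicit Defensive.

Import Order.TTheory GRing.Theory Num.Theory.

Local Open Scope ring_scope.

(** Two facts about a sum-free and product-free set [A] of residues mod [n]
    are combined.

    First, if the density of [A] exceeds 5/11 then sum-freeness alone forces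
    [n] to be even and [A] to consist of odd residues
    ([dense_sum_free_odd]).  Indeed the translates of [A] by its elements all
    lie in the complement of [A], which is barely larger than [A], so every
    difference of elements of [A] almost stabilises [A]; as no element of [A]
    does, such differences generate a proper subgroup that avoids [A], and it
    is too large to be anything but the even residues.  So it suffices to
    bound from below the proportion of odd residues that [A] misses.

    Second, for a set [I] of odd prime divisors of [n] with product [u_I], let
    [al I] be the proportion of units [g] such that [u_I * g] is missing from
    [A].  If [al I < 1] then [A] contains some [a = u_I * g0], and
    product-freeness says that [x] and [a * x] are never both in [A]; taking
    [x = u_J * g] with [J] disjoint from [I] gives
    [al I + al J + al (I :|: J) >= 1] in all cases ([missing_share_disjoint]).
    The density missed is at least [totient n / n] times the sum [M] of
    [al I / u_I] over all [I] ([missing_mass]).  Averaging the inequality over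
    all splittings of [2 k]-sets of primes into two [k]-sets ([averaging])
    bounds [M] below by a constant times the smaller of [lam ^ k / k!] and
    [lam ^ (2 k) / (2 k)!], where [lam] is the sum of the reciprocals of the
    odd prime divisors of [n] ([averaging_poisson]).  Up to the factor
    [expR (- lam)], which [totient n / n] supplies, these are Poisson
    probabilities, and they balance when [k] is about [e lam / 4]: both are
    then of order [4 ^ k / sqrt lam], that is
    [expR (e / 2 * ln 2 * lam) / sqrt lam] ([poisson_choice]).  This is where
    the exponent [1 - e / 2 * ln 2] comes from.

    It remains to see that [lam <= ln (ln (ln n)) + O(1)]
    ([sum_inv_prime_divisors]): the prime divisors of [n] above [ln n] are too
    few to matter, and for the others this is the upper bound in Mertens'
    second theorem, which follows from Chebyshev's bound on primorials and
    from the factorisation of [n!] by partial summation. *)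

(** * Divisibility by products of prime powers *)

Lemma prod_prime_powers_dvd (s : seq nat) (e : nat -> nat) m :
  uniq s -> (forall p, p \in s -> prime p) ->
  (forall p, p \in s -> p ^ e p %| m)%N -> (\prod_(p <- s) p ^ e p %| m)%N.
Proof.
elim: s => [|p s IH] /=; first by rewrite big_nil.
case/andP=> ps us prs dvs; rewrite big_cons Gauss_dvd.
  by rewrite dvs ?mem_head // IH // => q qs; [apply: prs|apply: dvs]; rewrite inE qs orbT.
rewrite big_seq; elim/big_ind: _ => [|x y cx cy|q qs]; rewrite ?coprimen1 //.
  by rewrite coprimeMr cx.
apply: coprimeXl; apply: coprimeXr.
rewrite prime_coprime ?prs ?mem_head // dvdn_prime2 ?prs ?mem_head //; last by rewrite inE qs orbT.
by apply: contraNneq ps => ->.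
Qed.

(** * Dense sum-free sets consist of odd residues *)

Section SumFree.
Variables (G : finZmodType) (A : {set G}).

Let shift d : {set G} := [set x + d | x in A]%SET.
(** How far [d] is from being a period of [A]. *)
Let rho d : nat := #|A :\: shift d|.

Let mem_shift x d : (x \in shift d) = (x - d \in A).
Proof.
apply/imsetP/idP => [[y yA ->]|xA]; first by rewrite addrK.
by exists (x - d) => //; rewrite subrK.
Qed.

Let card_shift d : #|shift d| = #|A|.
Proof. by apply: card_imset; apply: addIr. Qed.

Let rhoD d e : (rho (d + e) <= rho d + rho e)%N.
Proof.
have -> : rho e = #|[set x + d | x in A :\: shift e]%SET|.
  by rewrite card_imset //; apply: addIr.
apply: leq_trans (leq_card_setU _ _); apply: subset_leq_card.
apply/fintype.subsetP => x.
rewrite !inE !mem_shift => /andP[xde xA]; rewrite xA andbT.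
have [xd|//] := boolP (x - d \in A); rewrite /=.
apply/imsetP; exists (x - d); last by rewrite subrK.
by rewrite !inE xd andbT mem_shift -addrA -opprD.
Qed.

Hypothesis sfA : forall x y, x \in A -> y \in A -> x + y \notin A.
Hypothesis denseA : (5 * #|G| < 11 * #|A|)%N.

Let rho_mem d : d \in A -> rho d = #|A|.
Proof.
move=> dA; congr #|pred_of_set _|; apply/finset.setP => x.
rewrite !inE mem_shift; apply: andb_idl => xA.
by apply: contraL xA => xdA; rewrite -(subrK d x); apply: sfA.
Qed.

Let D : {set G} := [set x - y | x in A, y in A]%SET.

Let DP d : d \in D -> exists x y, [/\ x \in A, y \in A & d = x - y].
Proof. by move/imset2P=> [x y xA yA ->]; exists x, y. Qed.

Let DB x y : x \in A -> y \in A -> x - y \in D.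
Proof. by move=> xA yA; apply/imset2P; exists x y. Qed.

Let card_disjointU (X Y : {set G}) :
  (forall z, z \in X -> z \notin Y) -> #|X :|: Y| = (#|X| + #|Y|)%N.
Proof.
move=> XY; apply/eqP; rewrite (leq_card_setU X Y).2 finset.disjoints_subset.
by apply/fintype.subsetP => z /XY; rewrite inE.
Qed.

Let card_le (X : {set G}) : (#|X| <= #|G|)%N.
Proof. exact: max_card. Qed.

(** The translates of [A] by [x] and by [y] both lie in the complement of
    [A], so they differ by at most [#|G| - 2 * #|A|] elements. *)
Let rho_diff d : d \in D -> (rho d + 2 * #|A| <= #|G|)%N.
Proof.
case/DP => x [y [xA yA ->]].
pose S : {set G} := [set z + y | z in A :\: shift (x - y)]%SET.
have -> : rho (x - y) = #|S| by rewrite card_imset //; apply: addIr.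
have SP z : z \in S -> z \notin shift x :|: A.
  case/imsetP => t; rewrite !inE mem_shift => /andP[t1 tA] ->.
  by rewrite negb_or mem_shift (sfA tA yA) andbT -addrA -opprB.
have xP z : z \in shift x -> z \notin A.
  by case/imsetP => t tA ->; apply: sfA.
have := card_le (S :|: (shift x :|: A)).
by rewrite card_disjointU // card_disjointU // card_shift; lia.
Qed.

(** An almost period [d] maps [D] to almost periods, hence outside [A].  So [D]
    and its translate by [d] both avoid [A], which leaves them too little room
    to be disjoint. *)
Let small_rho d : (rho d <= 4 * (#|G| - 2 * #|A|))%N ->
  exists d1 d2, [/\ d1 \in D, d2 \in D & d = d1 - d2].
Proof.
move=> rd.
have notA e : (rho e < #|A|)%N -> e \notin A.
  by move=> re; apply/negP => /rho_mem E; rewrite E ltnn in re.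
have [x0 x0A] : exists x, x \in A by apply/card_gt0P; lia.
have leD : (#|A| <= #|D|)%N.
  rewrite -(card_imset (mem A) (addIr (- x0))); apply: subset_leq_card.
  by apply/fintype.subsetP => _ /imsetP[x xA ->]; apply: DB.
have cA : (2 * #|A| <= #|G|)%N.
  by have := rho_diff (DB x0A x0A); lia.
have D_A e : e \in D -> e \notin A.
  by move=> /rho_diff re; apply: notA; lia.
pose D' : {set G} := [set d + e | e in D]%SET.
have D'_A e : e \in D' -> e \notin A.
  by case/imsetP => f /rho_diff rf ->; apply: notA; have := rhoD d f; lia.
have : ~~ [disjoint D' & D].
  apply/negP => dis.
  have := card_le (D' :|: D :|: A).
  rewrite card_disjointU; last by move=> z /setUP[/D'_A|/D_A].
  rewrite card_disjointU; last by move=> z /(disjointFr dis) ->.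
  have : #|D'| = #|D| by apply: card_imset; apply: addrI.
  lia.
case/pred0Pn => e /= /andP[/imsetP[f fD ->] dfD].
by exists (d + f), f; rewrite addrK.
Qed.

(** The subgroup of almost periods.  The set [E] is closed under addition
    because a sum of two of its elements, although a priori a worse almost
    period, is again a difference of two elements of [D]. *)
Lemma sum_free_almost_period : exists E : {set G},
  [/\ forall x, x \in E -> x \notin A,
      forall x y, x \in E -> y \in E -> x + y \in E
    & forall x y, x \in A -> y \in A -> x - y \in E].
Proof.
pose E : {set G} := [set d | rho d <= 2 * (#|G| - 2 * #|A|)]%N%SET.
have DN d : d \in D -> - d \in D.
  by case/DP => x [y [xA yA ->]]; rewrite opprB; apply: DB.
have EP x : (x \in E) = (rho x <= 2 * (#|G| - 2 * #|A|))%N by rewrite inE.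
exists E; split => [x|x y|x y xA yA]; rewrite !EP.
- by move=> rx; apply/negP => /rho_mem; lia.
- move=> rx ry.
  have [|d1 [d2 [d1D /DN d2D ->]]] := @small_rho (x + y).
    by apply: leq_trans (rhoD x y) _; lia.
  have := rho_diff d1D; have := rho_diff d2D => ? ?.
  by apply: leq_trans (rhoD d1 (- d2)) _; lia.
- by have := rho_diff (DB xA yA); lia.
Qed.
End SumFree.

Lemma sum_freeP n (A : {set 'Z_n}) :
  reflect (forall x y, x \in A -> y \in A -> x + y \notin A) (sum_free A).
Proof.
rewrite /sum_free setI_eq0 disjoint_sym finset.disjoints_subset.
apply: (iffP fintype.subsetP) => [sf x y xA yA|sf z /imset2P[x y xA yA ->]].
  by have := sf _ (imset2_f _ xA yA); rewrite inE.
by rewrite inE; apply: sf.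
Qed.

Lemma product_freeP n (A : {set 'Z_n}) :
  reflect (forall x y, x \in A -> y \in A -> x * y \notin A) (product_free A).
Proof.
rewrite /product_free setI_eq0 disjoint_sym finset.disjoints_subset.
apply: (iffP fintype.subsetP) => [sf x y xA yA|sf z /imset2P[x y xA yA ->]].
  by have := sf _ (imset2_f _ xA yA); rewrite inE.
by rewrite inE; apply: sf.
Qed.

(** Since [A] has more than a third of the residues, two of its translates by
    [0], [1], [2] meet, so the subgroup of almost periods contains [1] or [2];
    it does not contain [1] because it avoids [A].  So it contains the
    multiples of [2], and [n] is even since otherwise [1] is one of them. *)
Lemma dense_sum_free_odd n (A : {set 'Z_n}) : (1 < n)%N ->
  sum_free A -> (5 * n < 11 * #|A|)%N ->
  ~~ odd n /\ forall x, x \in A -> odd x.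
Proof.
move=> n1 /sum_freeP sfA denseA.
have cZ : #|'Z_n| = n by rewrite card_ord Zp_cast.
have [|E [EA ED AE]] := sum_free_almost_period sfA; first by rewrite cZ.
have [x0 x0A] : exists x, x \in A by apply/card_gt0P; lia.
have E0 : 0 \in E by rewrite -(subrr x0); apply: AE.
have EM k x : x \in E -> x *+ k \in E.
  by move=> xE; elim: k => [|k IH]; rewrite ?mulr0n // mulrS; apply: ED.
have E1 : 1 \notin E.
  apply/negP => /(EM x0); rewrite Zp_nat valZpK => /EA.
  by rewrite x0A.
have E2 : 2%:R \in E.
  pose T c : {set 'Z_n} := [set x + c | x in A]%SET.
  have cT c : #|T c| = #|A| by apply: card_imset; apply: addIr.
  have ov c d : ~~ [disjoint T c & T d] -> c - d \in E.
    case/pred0Pn => e /= /andP[/imsetP[x xA ->] /imsetP[y yA xy]].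
    have -> : c - d = y - x by apply/eqP; rewrite subr_eq addrAC eq_sym subr_eq -xy addrC.
    exact: AE.
  have [d1|/ov] := boolP [disjoint T 1 & T 0]; last by rewrite subr0 (negbTE E1).
  have [d2|/ov] := boolP [disjoint T 2%:R & T 1]; last first.
    by rewrite mulr2n addrK (negbTE E1).
  have [d3|/ov] := boolP [disjoint T 2%:R & T 0]; last by rewrite subr0.
  have cU (X Y : {set 'Z_n}) : [disjoint X & Y] -> #|X :|: Y| = (#|X| + #|Y|)%N.
    by move=> XY; apply/eqP; rewrite (leq_card_setU X Y).2.
  have le_n (X : {set 'Z_n}) : (#|X| <= n)%N.
    by apply: leq_trans (max_card _) _; rewrite cZ.
  have := le_n (T 2%:R :|: (T 1 :|: T 0)).
  rewrite (cU (T 2%:R)); first by rewrite cU // !cT; lia.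
  rewrite finset.disjoints_subset finset.setCU finset.subsetI.
  by rewrite -!finset.disjoints_subset d2 d3.
have evenE k : ~~ odd k -> (k%:R : 'Z_n) \in E.
  move=> ok; rewrite -(odd_double_half k) (negbTE ok) add0n -mul2n natrM.
  by rewrite mulr_natr; apply: EM.
split=> [|x xA].
  apply/negP => on; have := evenE n.+1; rewrite /= on => /(_ isT).
  by rewrite mulrS pchar_Zp // addr0 (negbTE E1).
by apply/negPn/negP => /evenE; rewrite natr_Zp => /EA; rewrite xA.
Qed.

(** * Elementary symmetric functions and averaging over splittings *)

Section SymmetricFunctions.
Variables (R : realFieldType) (T : finType) (w : T -> R).
Hypothesis w_ge0 : forall p, 0 <= w p.

Definition setwt (I : {set T}) : R := \prod_(p in I) w p.

Definition elsym (k : nat) : R := \sum_(I : {set T} | #|I| == k) setwt I.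

Let lam : R := \sum_p w p.
Let sq : R := \sum_p w p ^+ 2.

Lemma setwt_ge0 I : 0 <= setwt I.
Proof. exact: prodr_ge0. Qed.

Lemma elsym_ge0 k : 0 <= elsym k.
Proof. by apply: sumr_ge0 => I _; apply: setwt_ge0. Qed.

Lemma elsym0 : elsym 0 = 1.
Proof.
rewrite /elsym (big_pred1 finset.set0) => [|I]; last by rewrite cards_eq0.
by rewrite /setwt big_set0.
Qed.

Lemma setwtD1 p (I : {set T}) : p \in I -> setwt I = w p * setwt (I :\ p).
Proof. by move=> pI; rewrite /setwt (big_setD1 p). Qed.

Lemma setwtD (I W : {set T}) :
  I \subset W -> setwt W = setwt I * setwt (W :\: I).
Proof.
by move=> IW; rewrite /setwt (big_setID I) /= (finset.setIidPr IW).
Qed.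

(** A [k.+1]-set with a marked element is a [k]-set together with an element
    outside it. *)
Lemma sum_pointed_sets k (F : T -> {set T} -> R) :
  \sum_(I : {set T} | #|I| == k.+1) \sum_(p in I) F p (I :\ p) =
  \sum_(J : {set T} | #|J| == k) \sum_(p | p \notin J) F p J.
Proof.
rewrite (exchange_big_dep xpredT) //= [RHS](exchange_big_dep xpredT) //=.
apply: eq_bigr => p _.
rewrite (reindex_onto (fun J => p |: J) (fun I => I :\ p)) /=; last first.
  by move=> I /andP[_ pI]; rewrite finset.setD1K.
apply: eq_big => J.
  rewrite finset.setU11 andbT cardsU1.
  have [pJ|pJ] := boolP (p \in J) => /=.
    rewrite andbF; apply/negbTE/nandP; right; apply: contraL pJ => /eqP <-.
    by rewrite !inE eqxx.
  by rewrite finset.setU1K // eqxx !andbT.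
by case/andP => _ /eqP ->.
Qed.

Lemma elsymS k : k.+1%:R * elsym k.+1 =
  \sum_(J : {set T} | #|J| == k) setwt J * (lam - \sum_(p in J) w p).
Proof.
transitivity (\sum_(I : {set T} | #|I| == k.+1)
                \sum_(p in I) w p * setwt (I :\ p)).
  rewrite mulr_sumr; apply: eq_bigr => I /eqP cI.
  under eq_bigr => p pI do rewrite -setwtD1 //.
  by rewrite sumr_const cI mulr_natl.
rewrite (sum_pointed_sets k (fun p J => w p * setwt J)).
apply: eq_bigr => J _; rewrite -mulr_suml mulrC; congr (_ * _).
by rewrite /lam [X in _ = X - _](bigID (mem J)) /= addrAC subrr add0r.
Qed.

Lemma elsymS_le k : k.+1%:R * elsym k.+1 <= lam * elsym k.
Proof.
rewrite elsymS mulr_sumr; apply: ler_sum => J _; rewrite mulrC.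
apply: ler_wpM2r; first exact: setwt_ge0.
by rewrite gerBl sumr_ge0.
Qed.

Lemma elsymSS_ge k :
  lam * elsym k.+1 - sq * elsym k <= k.+2%:R * elsym k.+2.
Proof.
rewrite elsymS; under eq_bigr => J _ do rewrite mulrBr.
rewrite sumrB -mulr_suml -/(elsym _) mulrC lerD2l lerN2.
have -> : \sum_(J : {set T} | #|J| == k.+1) setwt J * \sum_(p in J) w p =
          \sum_(J : {set T} | #|J| == k.+1)
            \sum_(p in J) w p ^+ 2 * setwt (J :\ p).
  apply: eq_bigr => J _; rewrite mulr_sumr; apply: eq_bigr => p pJ.
  by rewrite (setwtD1 pJ) expr2; ring.
rewrite (sum_pointed_sets k (fun p J => w p ^+ 2 * setwt J)) mulr_sumr.
apply: ler_sum => J _; rewrite -mulr_suml.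
apply: ler_wpM2r; first exact: setwt_ge0.
rewrite /sq [leRHS](bigID (mem J)) /= lerDr.
by apply: sumr_ge0 => p _; rewrite exprn_ge0.
Qed.

Let lam_ge0 : 0 <= lam. Proof. exact: sumr_ge0. Qed.
Let sq_ge0 : 0 <= sq.
Proof. by apply: sumr_ge0 => p _; rewrite exprn_ge0. Qed.

Lemma fact_elsym_le k : k`!%:R * elsym k <= lam ^+ k.
Proof.
elim: k => [|k IH]; first by rewrite fact0 elsym0 mul1r.
rewrite factS natrM mulrAC mulrC.
apply: (@le_trans _ _ (k`!%:R * (lam * elsym k))).
  by apply: ler_wpM2l => //; apply: elsymS_le.
by rewrite mulrCA exprS ler_wpM2l.
Qed.

(** Among all [k]-tuples, those with a repeated entry weigh at most
    ['C(k, 2) * sq * lam ^+ (k - 2)]; stated through [elsymSS_ge], the bound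
    follows by induction without mentioning tuples. *)
Lemma fact_elsym_ge k :
  lam ^+ k - 'C(k, 2)%:R * sq * lam ^+ (k - 2) <= k`!%:R * elsym k.
Proof.
elim/ltn_ind: k => -[|[|k]] IH.
- by rewrite fact0 elsym0 mul1r bin_small // mul0r mul0r subr0.
- rewrite bin_small // !mul0r subr0.
  by rewrite (factS 0) fact0 muln1 elsymS
     (big_pred1 finset.set0) => [|I]; rewrite ?cards_eq0 //
     /setwt !big_set0 subr0 mul1r expr1.
have IH1 := IH k.+1 (ltnSn _).
have le_k := fact_elsym_le k.
have -> : k.+2`!%:R * elsym k.+2 = k.+1`!%:R * (k.+2%:R * elsym k.+2).
  by rewrite (factS k.+1) natrM; ring.
apply: (@le_trans _ _ (k.+1`!%:R * (lam * elsym k.+1 - sq * elsym k))); last first.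
  by apply: ler_wpM2l => //; apply: elsymSS_ge.
rewrite mulrBr (mulrCA k.+1`!%:R).
apply: (@le_trans _ _ (lam * (lam ^+ k.+1 - 'C(k.+1, 2)%:R * sq * lam ^+ (k.+1 - 2))
                       - k.+1%:R * sq * lam ^+ k)); last first.
  apply: lerB; first exact: ler_wpM2l.
  rewrite factS natrM -!mulrA; apply: ler_wpM2l => //; rewrite mulrCA.
  exact: ler_wpM2l.
have -> : lam * (lam ^+ k.+1 - 'C(k.+1, 2)%:R * sq * lam ^+ (k.+1 - 2)) =
   lam ^+ k.+2 - 'C(k.+1, 2)%:R * sq * lam ^+ k.
  case: k {IH IH1 le_k} => [|k]; first by rewrite bin_small // !mul0r !subr0 -exprS.
  by rewrite subSS subn1 /= mulrBr -exprS; congr (_ - _); rewrite [in RHS]exprS; ring.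
rewrite (_ : k.+2 - 2 = k)%N; last by lia.
by rewrite binS bin1 natrD le_eqVlt; apply/orP; left; apply/eqP; ring.
Qed.

Section Averaging.
Variable al : {set T} -> R.
Hypothesis al_ge0 : forall I, 0 <= al I.
Hypothesis al_disjoint : forall I J : {set T},
  [disjoint I & J] -> 1 <= al I + al J + al (I :|: J).

Let M : R := \sum_(I : {set T}) setwt I * al I.

Let M_ge (P : pred {set T}) : \sum_(I | P I) setwt I * al I <= M.
Proof.
rewrite /M [leRHS](bigID P) /= lerDl.
by apply: sumr_ge0 => I _; rewrite mulr_ge0 ?setwt_ge0.
Qed.

Let half k (W I : {set T}) := (I \subset W) && (#|I| == k).

(** The complements [W :\: I] are distinct [k]-sets. *)
Let sum_supersets k (I : {set T}) : #|I| = k ->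
  \sum_(W : {set T} | (#|W| == k.*2) && (I \subset W)) setwt (W :\: I)
  <= elsym k.
Proof.
move=> cI.
rewrite (reindex_onto (fun J => I :|: J) (fun W => W :\: I)) /=; last first.
  move=> W /andP[_ IW]; apply/finset.setP => x; rewrite !inE.
  by case: (boolP (x \in I)) => //= /(fintype.subsetP IW).
rewrite /elsym big_mkcond [leRHS]big_mkcond /=; apply: ler_sum => J _.
case: ifP => [/andP[/andP[/eqP cW _] /eqP DJ]|_]; last first.
  by case: ifP => // _; apply: setwt_ge0.
rewrite DJ ifT // -DJ cardsD cW.
by rewrite (finset.setIidPr (finset.subsetUl _ _)) cI -addnn addnK.
Qed.

(** The hypothesis on [al] is summed over all ways of splitting a [2 k]-set [W]
    into [k]-sets [I] and [W :\: I], with weight [setwt W].  The terms [al W]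
    are counted ['C(2 k, k)] times each; the two halves contribute equally, and
    a given [I] is completed by [k]-sets of total weight at most [elsym k]. *)
Lemma averaging k :
  'C(k.*2, k)%:R * elsym k.*2 <= ('C(k.*2, k)%:R + 2 * elsym k) * M.
Proof.
pose C : R := 'C(k.*2, k)%:R; rewrite -/C.
have sumC (W : {set T}) (x : R) : #|W| == k.*2 ->
    \sum_(I | half k W I) x = C * x.
  move=> /eqP cW; rewrite sumr_const mulr_natl -cW -cards_draws; congr (_ *+ _).
  by apply: eq_card => I; rewrite !inE.
have cptl (W I : {set T}) : #|W| == k.*2 -> half k W I -> half k W (W :\: I).
  move=> /eqP cW /andP[IW /eqP cI]; rewrite /half finset.subsetDl cardsD.
  by rewrite (finset.setIidPr IW) cW cI -addnn addnK eqxx.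
pose X := \sum_(W : {set T} | #|W| == k.*2)
            \sum_(I | half k W I) setwt W * al I.
have leX : X <= elsym k * M.
  rewrite /X (exchange_big_dep (fun I : {set T} => #|I| == k)) /=; last first.
    by move=> W I _ /andP[].
  apply: (@le_trans _ _ (\sum_(I : {set T} | #|I| == k) elsym k * (setwt I * al I))).
    apply: ler_sum => I /eqP cI.
    apply: le_trans (ler_wpM2r _ (sum_supersets cI)); last first.
      by rewrite mulr_ge0 ?setwt_ge0.
    rewrite mulr_suml le_eqVlt; apply/orP; left; apply/eqP.
    apply: eq_big => W; first by rewrite /half cI eqxx andbT.
    by case/andP => _ /andP[IW _]; rewrite (setwtD IW); ring.
  by rewrite -mulr_sumr ler_wpM2l ?elsym_ge0.
have XE : \sum_(W : {set T} | #|W| == k.*2)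
            \sum_(I | half k W I) setwt W * al (W :\: I) = X.
  apply: eq_bigr => W cW.
  have DD I : half k W I -> W :\: (W :\: I) = I.
    by case/andP => IW _; rewrite finset.setDDr finset.setDv finset.set0U; apply/finset.setIidPr.
  rewrite (reindex_onto (fun I => W :\: I) (fun I => W :\: I)) //=.
  apply: eq_big => I; last by case/andP => _ /eqP ->.
  apply/andP/idP => [[h /eqP <-]|h]; first exact: cptl.
  by rewrite DD // eqxx; split => //; apply: cptl.
apply: (@le_trans _ _ (C * M + X + X)); last first.
  have -> : (C + 2 * elsym k) * M = C * M + elsym k * M + elsym k * M by ring.
  by rewrite !lerD.
rewrite -{2}XE.
apply: (@le_trans _ _ (\sum_(W : {set T} | #|W| == k.*2) \sum_(I | half k W I)
   (setwt W * al W + setwt W * al I + setwt W * al (W :\: I)))).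
  rewrite mulr_sumr; apply: ler_sum => W cW; rewrite -(sumC _ _ cW).
  apply: ler_sum => I /andP[IW _].
  rewrite -!mulrDr ler_peMr ?setwt_ge0 // -addrA addrC.
  rewrite -{2}(finset.setID W I) (finset.setIidPr IW).
  apply: al_disjoint; rewrite finset.disjoints_subset.
  by apply/fintype.subsetP => x; rewrite !inE => ->.
under eq_bigr => W cW do rewrite !big_split /= sumC //.
by rewrite !big_split /= -mulr_sumr !lerD2r ler_wpM2l.
Qed.

(** With [b] and [a] the two ratios bounded below by [q], one has
    ['C(2 k, k) * a = b ^+ 2], [elsym k <= b] and, under the first two
    hypotheses, [elsym (2 k) >= a / 4]; the averaged inequality then reads
    [1 / 4 <= (1 / a + 2 / b) * M]. *)
Lemma averaging_poisson k q :
    sq <= 1 / 2 -> 4 * k%:R ^+ 2 <= 3 * lam ^+ 2 -> 0 < q ->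
    q <= lam ^+ k / k`!%:R -> q <= lam ^+ k.*2 / k.*2`!%:R ->
  q <= 12 * M.
Proof.
move=> sq2 kl q0 qb qa.
set b := _ / _ in qb; set a := _ / _ in qa.
have f0 j : 0 < j`!%:R :> R by rewrite ltr0n fact_gt0.
have a0 : 0 < a by apply: lt_le_trans qa.
have b0 : 0 < b by apply: lt_le_trans qb.
have Cab : 'C(k.*2, k)%:R * a = b ^+ 2.
  rewrite /a /b expr_div_n -exprM muln2 mulrA.
  have := congr1 (fun m => m%:R : R) (bin_fact (leq_addr k k)).
  rewrite addnn -addnn addnK addnn !natrM => <-.
  have := f0 k; have : 0 < 'C(k.*2, k)%:R :> R by rewrite ltr0n bin_gt0 -addnn leq_addr.
  by move=> /lt0r_neq0 ? /lt0r_neq0 ?; field; apply/andP.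
have eb : elsym k <= b by rewrite ler_pdivlMr // mulrC fact_elsym_le.
have ea : a / 4 <= elsym k.*2.
  rewrite -(ler_pM2l (f0 k.*2)); apply: le_trans (fact_elsym_ge _).
  rewrite /a mulrA mulrCA divff ?lt0r_neq0 // mulr1.
  case: k {qb qa b a a0 b0 Cab eb} kl => [|k] kl.
    by rewrite double0 bin_small // !mul0r subr0 expr0; lra.
  set k2 := k.+1.*2.
  have -> : lam ^+ k2 = lam ^+ 2 * lam ^+ (k2 - 2) by rewrite -exprD subnKC.
  rewrite [_ * _ / 4]mulrAC -mulrBl ler_wpM2r ?exprn_ge0 //.
  have C2 : 'C(k2, 2)%:R * 2 <= 4 * k.+1%:R ^+ 2 :> R.
    rewrite -natrX -!natrM ler_nat bin2 -divn2 muln2 -mul2n.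
    apply: leq_trans (_ : k2 * k2.-1 <= _)%N.
      by rewrite mulnC leq_divM.
    by rewrite /k2; nia.
  have : 'C(k2, 2)%:R * sq <= 'C(k2, 2)%:R * (1 / 2) :> R by rewrite ler_wpM2l.
  by lra.
have M0 : 0 <= M by apply: sumr_ge0 => I _; rewrite mulr_ge0 ?setwt_ge0.
have main : b * a / 4 <= (b + 2 * a) * M.
  rewrite -(ler_pM2l b0).
  have -> : b * (b * a / 4) = a * ('C(k.*2, k)%:R * (a / 4)).
    by transitivity (b ^+ 2 * (a / 4)); [ring|rewrite -Cab; ring].
  have -> : b * ((b + 2 * a) * M) = a * (('C(k.*2, k)%:R + 2 * b) * M).
    by transitivity ((b ^+ 2 + 2 * a * b) * M); [ring|rewrite -Cab; ring].
  rewrite ler_pM2l //.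
  apply: le_trans (ler_wpM2l (ler0n _ _) ea) _.
  apply: le_trans (averaging k) _.
  by rewrite ler_wpM2r // lerD2l ler_wpM2l.
rewrite -(ler_pM2l (mulr_gt0 b0 a0)).
have h1 : b * M * q <= b * M * a by rewrite ler_wpM2l // mulr_ge0 // ltW.
have h2 : a * M * q <= a * M * b by rewrite ler_wpM2l // mulr_ge0 // ltW.
have : b * a / 4 * q <= (b + 2 * a) * M * q by rewrite ler_wpM2r // ltW.
by lra.
Qed.
End Averaging.
End SymmetricFunctions.

(** * Odd residues missed by a product-free set *)

Section ProductFree.
Variables (R : realFieldType) (n : nat) (A : {set 'Z_n}).
Hypothesis n_gt1 : (1 < n)%N.
Hypothesis n_even : ~~ odd n.
Hypothesis pfA : product_free A.
Hypothesis oddA : forall x, x \in A -> odd x.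

Variables (T : finType) (pr : T -> nat).
Hypothesis pr_prime : forall p, prime (pr p).
Hypothesis pr_odd : forall p, odd (pr p).
Hypothesis pr_dvd : forall p, (pr p %| n)%N.
Hypothesis pr_inj : injective pr.

Let u (I : {set T}) : nat := (\prod_(p in I) pr p)%N.
Let U : {set 'Z_n} := [set g : 'Z_n | g \is a GRing.unit].
Let miss (I : {set T}) : {set 'Z_n} := [set g in U | (u I)%:R * g \notin A].

(** Parametrising the residues with greatest common divisor [u I] with [n] by
    units makes multiplication by such a residue act as a bijection. *)
Definition missing_share (I : {set T}) : R := #|miss I|%:R / (totient n)%:R.

Let n_gt0 : (0 < n)%N. Proof. exact: ltnW. Qed.
Let Zn : (Zp_trunc n).+2 = n. Proof. exact: Zp_cast. Qed.

Let ltZ (x : 'Z_n) : (x < n)%N.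
Proof. by rewrite -[X in (_ < X)%N]Zn ltn_ord. Qed.

Let val_mul (m : nat) (g : 'Z_n) : (m%:R * g : 'Z_n) = (m * g %% n)%N :> nat.
Proof. by rewrite -{1}[g]natr_Zp -natrM val_Zp_nat. Qed.

Let dvd_mul d (m : nat) (g : 'Z_n) :
  (d %| n)%N -> (d %| (m%:R * g : 'Z_n)%R)%N = (d %| m * g)%N.
Proof. by move=> dn; rewrite val_mul /dvdn modn_dvdm. Qed.

Let U_coprime g : (g \in U) = coprime n g.
Proof. by rewrite inE -{1}[g]natr_Zp unitZpE. Qed.

Let cardU : #|U| = totient n.
Proof.
rewrite totient_count_coprime.
have -> : (\sum_(0 <= d < n) coprime n d =
           \sum_(0 <= d < (Zp_trunc n).+2) coprime n d)%N by rewrite Zn.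
rewrite big_mkord -sum1_card big_mkcond /=; apply: eq_bigr => g _.
by rewrite U_coprime; case: coprime.
Qed.

Let u_prime_dvd p I : (pr p %| u I)%N = (p \in I).
Proof.
apply/idP/idP => [|pI]; last by rewrite /u (big_setD1 p) //= dvdn_mulr.
rewrite Euclid_dvd_prod // big_orE => /existsP[q /andP[qI]].
by rewrite dvdn_prime2 // => /eqP /pr_inj ->.
Qed.

Let u_dvd I : (u I %| n)%N.
Proof.
have -> : u I = (\prod_(p <- [seq pr i | i in I]) p ^ 1)%N.
  by rewrite big_image; apply: eq_bigr => p _; rewrite expn1.
apply: (@prod_prime_powers_dvd _ (fun=> 1%N)) => [|_ /mapP[p _ ->]|_ /mapP[p _ ->]].
- by rewrite map_inj_uniq ?enum_uniq.
- exact: pr_prime.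
- by rewrite expn1 pr_dvd.
Qed.

Let u_gt0 I : (0 < u I)%N.
Proof. by rewrite (dvdn_gt0 n_gt0 (u_dvd I)). Qed.

Let u_odd I : odd (u I).
Proof.
by rewrite /u; elim/big_ind: _ => // x y ox oy; rewrite oddM ox.
Qed.

Let uU (I J : {set T}) : [disjoint I & J] -> u (I :|: J) = (u I * u J)%N.
Proof.
by move=> IJ; rewrite /u (eq_bigl [predU I & J]) ?bigU //= => x; rewrite !inE.
Qed.

Let cardU_gt0 : 0 < (totient n)%:R :> R.
Proof. by rewrite ltr0n totient_gt0. Qed.

Lemma missing_share_ge0 I : 0 <= missing_share I.
Proof. by rewrite divr_ge0. Qed.

(** If [A] contains [u I * g0] then, for every unit [g], it misses [u J * g] or
    the product [u (I :|: J) * (g0 * g)]. *)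
Lemma missing_share_disjoint (I J : {set T}) : [disjoint I & J] ->
  1 <= missing_share I + missing_share J + missing_share (I :|: J).
Proof.
move=> IJ; rewrite -!mulrDl ler_pdivlMr // mul1r -!natrD ler_nat -cardU.
have [/fintype.subsetP UI|] := boolP (U \subset miss I).
  by rewrite -addnA; apply: leq_trans (leq_addr _ _); apply/subset_leq_card/fintype.subsetP.
case/subsetPn => g0 g0U; rewrite inE g0U negbK => g0A.
have g0u : g0 \is a GRing.unit by move: g0U; rewrite inE.
pose S : {set 'Z_n} := [set g | g0 * g \in miss (I :|: J)].
have cS : (#|S| <= #|miss (I :|: J)|)%N.
  rewrite -(card_imset (mem S) (mulrI g0u)); apply: subset_leq_card.
  by apply/fintype.subsetP => _ /imsetP[g gS ->]; move: gS; rewrite inE.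
have : U \subset miss J :|: S.
  apply/fintype.subsetP => g gU; have gu : g \is a GRing.unit by move: gU; rewrite inE.
  rewrite !inE gu /= unitrM g0u gu /= uU // natrM mulrACA.
  rewrite -negb_and; apply/negP => /andP[gA].
  by rewrite (negbTE (product_freeP _ pfA _ _ g0A gA)).
move/subset_leq_card => h; apply: leq_trans h _.
apply: leq_trans (leq_card_setU _ _) _.
by apply: leq_trans (leq_add (leqnn _) cS) _; rewrite -addnA leq_addl.
Qed.

Let mass (I : {set T}) : {set 'Z_n} := [set (u I)%:R * g | g in miss I]%SET.

(** Multiplication by [u I] is at most [u I] to one, since the solutions of
    [u I * g = y] are congruent modulo [n / u I]. *)
Let card_mass I : (#|miss I| <= u I * #|mass I|)%N.
Proof.
rewrite -sum1_card (partition_big_imset (fun g => (u I)%:R * g)) /=.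
rewrite -/(mass I) mulnC -sum_nat_const; apply: leq_sum => y _.
have [m nE] := dvdnP (u_dvd I).
(* [g] is determined by [g %% m] and [g %/ m], the latter being less than [u I]. *)
have m0 : (0 < m)%N by move: n_gt0; rewrite nE muln_gt0 => /andP[].
rewrite sum1dep_card -[leqRHS]card_ord.
have lt_u (g : 'Z_n) : (g %/ m < u I)%N by rewrite ltn_divLR // mulnC -nE.
pose f (g : 'Z_n) : 'I_(u I) := Ordinal (lt_u g).
rewrite -(@card_in_imset _ _ f) ?max_card //.
move=> g h; rewrite !inE => /andP[_ /eqP gy] /andP[_ /eqP hy] [ghm].
have um : (u I * m)%N = n by rewrite nE mulnC.
have : (u I * (g %% m) == u I * (h %% m))%N.
  by rewrite !muln_modr um -!val_mul gy hy.
rewrite eqn_pmul2l // => /eqP ghmod.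
by apply/val_inj; rewrite /= (divn_eq g m) (divn_eq h m) ghm ghmod.
Qed.

Let massP I x : x \in mass I ->
  [/\ x \notin A, odd x & forall p, (pr p %| x)%N = (p \in I)].
Proof.
case/imsetP => g; rewrite inE => /andP[gU gA] ->.
have cg : coprime n g by rewrite -U_coprime.
have n2 : (2 %| n)%N by rewrite dvdn2.
split=> // [|p].
  rewrite -[odd _]negbK -dvdn2 dvd_mul // dvdn2 negbK oddM u_odd /=.
  have := coprime_dvdl n2 cg; rewrite coprime2n //.
rewrite dvd_mul // Euclid_dvdM // u_prime_dvd orb_idr // => pg.
have := coprime_dvdl (pr_dvd p) cg; rewrite prime_coprime //.
by rewrite pg.
Qed.

(** The sets [mass I] are disjoint because [I] can be read off from the primes
    dividing an element; together with [A] they fit into the odd residues, of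
    which there are [n / 2]. *)
Lemma missing_mass :
  #|A|%:R + (totient n)%:R *
    \sum_I setwt (fun p => (pr p)%:R^-1 : R) I * missing_share I
  <= n%:R / 2 :> R.
Proof.
have wtE I : setwt (fun p => (pr p)%:R^-1 : R) I = (u I)%:R^-1.
  by rewrite /setwt prodfV -natr_prod.
apply: (@le_trans _ _ (#|A|%:R + \sum_I #|mass I|%:R)).
  rewrite lerD2l mulr_sumr; apply: ler_sum => I _.
  rewrite wtE mulrCA /missing_share [X in _ * X]mulrC -mulrA mulVf ?lt0r_neq0 //.
  by rewrite mulr1 mulrC ler_pdivrMr ?ltr0n // -natrM mulnC ler_nat card_mass.
have massD I J : I != J -> [disjoint mass I & mass J].
  move=> IJ; rewrite finset.disjoints_subset; apply/fintype.subsetP => x xI.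
  rewrite inE; apply: contra IJ => xJ; apply/eqP/finset.setP => p.
  by have [_ _ <-] := massP xI; have [_ _ <-] := massP xJ.
pose S := A :|: \bigcup_I mass I.
have cS : #|S| = (#|A| + \sum_I #|mass I|)%N.
  rewrite -[X in (_ + X)%N](eq_bigr _ (fun I _ => sum1_card (mem (mass I)))).
  rewrite -partition_disjoint_bigcup // sum1_card.
  apply/eqP; rewrite (leq_card_setU _ _).2 bigcup_disjoint // => I _.
  rewrite disjoint_sym finset.disjoints_subset; apply/fintype.subsetP => x.
  by rewrite inE => /massP[].
rewrite -natr_sum -natrD -cS ler_pdivlMr // -natrM ler_nat.
have oddS x : x \in S -> odd x.
  by case/setUP => [/oddA //|/bigcupP[I _ /massP[]]].
pose S1 : {set 'Z_n} := [set x + 1 | x in S]%SET.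
have evenS1 x : x \in S1 -> ~~ odd x.
  case/imsetP => y /oddS yo ->.
  have -> : y + 1 = y.+1%:R by rewrite -addn1 natrD natr_Zp.
  rewrite val_Zp_nat // -dvdn2 /dvdn modn_dvdm ?dvdn2 //.
  by rewrite -[_ == _]/(2 %| y.+1)%N dvdn2 /= yo.
have cS1 : #|S1| = #|S| by apply: card_imset; apply: addIr.
rewrite muln2 -addnn -[X in (_ + X)%N]cS1.
have <- : #|S :|: S1| = (#|S| + #|S1|)%N.
  apply/eqP; rewrite (leq_card_setU _ _).2 finset.disjoints_subset.
  by apply/fintype.subsetP => x /oddS ox; rewrite inE; apply: contraL ox => /evenS1.
by apply: leq_trans (max_card _) _; rewrite card_ord Zn.
Qed.
End ProductFree.

(** * Poisson weights *)

Section Factorials.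
Variable R : realType.
Import numFieldNormedType.Exports.

Lemma expR1_le : expR 1 <= 27 / 8 :> R.
Proof.
have h : 2 / 3 <= expR (- (1 / 3)) :> R.
  by apply: le_trans (expR_ge1Dx _); lra.
have : (2 / 3) ^+ 3 <= expR (- (1 / 3)) ^+ 3 :> R by rewrite lerXn2r ?nnegrE ?expR_ge0 //; lra.
rewrite -expRM_natl (_ : 3%:R * _ = -1); last by lra.
rewrite expRN -(ler_pM2r (expR_gt0 1)) mulVf; first by lra.
by rewrite gt_eqF ?expR_gt0.
Qed.

(** The midpoint estimate [2 * y <= ln ((1 + y) / (1 - y))], exponentiated: both
    sides agree at [0], and their difference has the derivative
    [1 - (1 - 2 * y) * expR (2 * y)], which is nonnegative because
    [expR (- 2 * y) >= 1 - 2 * y]. *)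
Lemma expR_double_le (y : R) : 0 <= y -> (1 - y) * expR (2 * y) <= 1 + y.
Proof.
move=> y0; rewrite mulr_natl mulr2n expRD.
pose f (x : R) := (1 + x) - (1 - x) * (expR x * expR x).
have df (x : R) : is_derive x (1 : R) f (1 - (1 - 2 * x) * (expR x * expR x)).
  apply: is_derive_eq; rewrite /GRing.scale /=; ring.
have [|c cI] := MVT_segment y0 (fun x _ => df x).
  apply: derivable_within_continuous => x _.
  by apply/ex_derive; exact: df.
rewrite /f expR0 => fy.
have c0 : 0 <= c by move: cI; rewrite in_itv /= => /andP[].
have h : 0 <= 1 - (1 - 2 * c) * (expR c * expR c).
  have := expR_ge1Dx (- (c + c)); rewrite expRN expRD.
  rewrite -(ler_pM2r (mulr_gt0 (expR_gt0 c) (expR_gt0 c))) mulVf; first by lra.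
  by rewrite gt_eqF // mulr_gt0 ?expR_gt0.
have := mulr_ge0 h y0.
lra.
Qed.

(** Squaring turns Stirling's bound [k! <= e * sqrt k * (k / e) ^ k] into a
    statement with integer exponents.  The induction step is
    [e ^ 2 <= (1 + 1 / k) ^ (2 k + 1)], i.e. the previous lemma at
    [y = 1 / (2 k + 1)]. *)
Lemma sqr_fact_le k : (0 < k)%N ->
  k`!%:R ^+ 2 * expR 1 ^+ k.*2 <= expR 1 ^+ 2 * k%:R ^+ k.*2.+1 :> R.
Proof.
case: k => // k _; elim: k => [|k IH].
  by rewrite !expr1n mul1r mulr1.
have step : expR 1 ^+ 2 * k.+1%:R ^+ k.+1.*2.+1 <= k.+2%:R ^+ k.+1.*2.+1 :> R.
  have k0 : 0 < k.+1%:R :> R by [].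
  pose y : R := (k.+1.*2.+1%:R)^-1.
  have y0 : 0 < y by rewrite invr_gt0.
  have k2E : k.+1.*2.+1%:R = 2 * k.+1%:R + 1 :> R by rewrite -addn1 natrD -mul2n natrM.
  have := expR_double_le (ltW y0).
  have yE : y * (2 * k.+1%:R + 1) = 1 by rewrite -k2E mulVf.
  have -> : 1 - y = y * (2 * k.+1%:R) by lra.
  have -> : 1 + y = y * (2 * k.+2%:R) by rewrite -[k.+2]addn1 natrD; lra.
  rewrite -mulrA ler_pM2l // -mulrA ler_pM2l // => h.
  have -> : expR 1 ^+ 2 = expR (2 * y) ^+ k.+1.*2.+1 :> R.
    rewrite -expRM_natl -expRM_natl; congr expR.
    by rewrite k2E mulr1; lra.
  by rewrite -exprMn mulrC lerXn2r ?nnegrE.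
rewrite factS natrM doubleS.
have -> : (k.+2%:R * k.+1`!%:R) ^+ 2 * expR 1 ^+ (k.+1).*2.+2 =
   k.+2%:R ^+ 2 * expR 1 ^+ 2 * (k.+1`!%:R ^+ 2 * expR 1 ^+ k.+1.*2) :> R.
  by rewrite -[(k.+1).*2.+2]addn2 exprD; ring.
have -> : expR 1 ^+ 2 * k.+2%:R ^+ k.+1.*2.+3 =
   k.+2%:R ^+ 2 * expR 1 ^+ 2 * k.+2%:R ^+ k.+1.*2.+1 :> R.
  by rewrite -[(k.+1).*2.+3]/(2 + k.+1.*2.+1)%N exprD; ring.
have c0 : 0 < k.+2%:R ^+ 2 * expR 1 ^+ 2 :> R by rewrite mulr_gt0 // exprn_gt0 // expR_gt0.
by rewrite ler_pM2l //; apply: le_trans IH _.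
Qed.

Lemma pow_fact_ge j (c lam : R) : 0 <= c -> c * j%:R <= expR 1 * lam ->
  c ^+ j <= expR 1 * Num.sqrt j.+1%:R * (lam ^+ j / j`!%:R).
Proof.
move=> c0 cj.
have e1 : 1 <= expR 1 :> R by rewrite -expR0 ler_expR.
have e0 : 0 < expR 1 :> R by apply: expR_gt0.
case: j cj => [|j] cj.
  by rewrite !expr0 sqrtr1 fact0 divr1 !mulr1.
have lam0 : 0 <= lam.
  by rewrite -(pmulr_rge0 _ e0); apply: le_trans cj; rewrite mulr_ge0.
have f0 : 0 < j.+1`!%:R :> R by rewrite ltr0n fact_gt0.
have s0 : 0 <= Num.sqrt j.+1%:R :> R by apply: sqrtr_ge0.
apply: (@le_trans _ _ (expR 1 * Num.sqrt j.+1%:R * (lam ^+ j.+1 / j.+1`!%:R))); last first.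
  apply: ler_wpM2r; first by rewrite divr_ge0 ?exprn_ge0.
  apply: ler_wpM2l; first exact: ltW.
  by rewrite ler_sqrt ?ler_nat.
have r0 : 0 <= expR 1 * Num.sqrt j.+1%:R * (lam ^+ j.+1 / j.+1`!%:R).
  by rewrite !mulr_ge0 ?exprn_ge0 ?invr_ge0 // ltW.
rewrite -(@ler_pXn2r _ 2) ?nnegrE ?exprn_ge0 // -exprM muln2.
rewrite !exprMn sqr_sqrtr // exprVn -exprM muln2.
rewrite mulrA ler_pdivlMr ?exprn_gt0 //.
have t0 : 0 < expR 1 ^+ j.+1.*2 * j.+1%:R ^+ j.+1.*2 :> R.
  by rewrite mulr_gt0 ?exprn_gt0.
rewrite -(ler_pM2r t0).
have := ler_pM _ _ (sqr_fact_le (ltn0Sn j)) (_ : (c * j.+1%:R) ^+ j.+1.*2 <= (expR 1 * lam) ^+ j.+1.*2).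
move=> h; apply: le_trans (le_trans (h _ _ _) _).
- by rewrite exprMn le_eqVlt; apply/orP; left; apply/eqP; ring.
- by rewrite mulr_ge0 ?exprn_ge0 // ltW.
- by rewrite exprn_ge0 // mulr_ge0.
- by rewrite lerXn2r ?nnegrE ?mulr_ge0 // ltW.
- by rewrite exprMn (exprS _ j.+1.*2) le_eqVlt; apply/orP; left; apply/eqP; ring.
Qed.

(** The growth rate of [4 ^ k] for [k = e lam / 4], see [poisson_choice]. *)
Definition poisson_exponent : R := expR 1 / 2 * ln 2.

(** The function [ln x / x] is maximal at [x = e]. *)
Lemma poisson_exponent_le1 : poisson_exponent <= 1.
Proof.
have := expR_ge1Dx (ln 2 - 1 : R); rewrite expRB lnK ?posrE // addrC subrK.
rewrite ler_pdivlMr ?expR_gt0 // /poisson_exponent; lra.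
Qed.

(** Take [k] just below [e lam / 4].  Then [4 k <= e lam] and
    [2 (2 k) <= e lam], so that [pow_fact_ge] with [c = 4] at [k] and with
    [c = 2] at [2 k] produces the same main term [4 ^ k = 2 ^ (2 k)]. *)
Lemma poisson_choice (lam : R) : 0 <= lam -> exists k : nat,
  let q := expR (poisson_exponent * lam) / (32 * Num.sqrt (1 + lam)) in
  [/\ 4 * k%:R ^+ 2 <= 3 * lam ^+ 2, q <= lam ^+ k / k`!%:R
    & q <= lam ^+ k.*2 / k.*2`!%:R].
Proof.
move=> lam0.
have e0 : 0 < expR 1 :> R by apply: expR_gt0.
pose k := Num.truncn (expR 1 * lam / 4).
have x0 : 0 <= expR 1 * lam / 4 by rewrite divr_ge0 // mulr_ge0 // ltW.
have /andP[k1 k2] := truncn_itv x0; rewrite -/k in k1 k2.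
have eh := expR1_le.
have el : expR 1 * lam <= 27 / 8 * lam by rewrite ler_wpM2r.
have k4 : 4%:R * k%:R <= expR 1 * lam by lra.
have sq0 : 0 < Num.sqrt (1 + lam) by rewrite sqrtr_gt0; lra.
have pw : expR (poisson_exponent * lam) <= 4 * 4%:R ^+ k.
  rewrite -exprS -[X in _ <= X ^+ _](@lnK R) ?posrE // -expRM_natl ler_expR.
  have -> : 4%:R = 2 ^+ 2 :> R by lra.
  rewrite lnXn // -mulr_natl /poisson_exponent.
  have l2 : 0 <= ln 2 :> R by apply: ln_ge0; lra.
  have : ln 2 * (expR 1 * lam / 4) <= ln 2 * k.+1%:R by rewrite ler_wpM2l // ltW.
  by lra.
have qle j a : (j <= k.*2)%N -> 4%:R ^+ k <= expR 1 * Num.sqrt j.+1%:R * a ->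
   expR (poisson_exponent * lam) / (32 * Num.sqrt (1 + lam)) <= a.
  move=> jk h; rewrite ler_pdivrMr ?mulr_gt0 //.
  have a0 : 0 <= a.
    rewrite -(pmulr_rge0 _ (_ : 0 < expR 1 * Num.sqrt j.+1%:R)).
      by apply: le_trans h; rewrite exprn_ge0.
    by rewrite mulr_gt0 // sqrtr_gt0.
  have sj : Num.sqrt j.+1%:R <= 2 * Num.sqrt (1 + lam).
    have -> : 2 = Num.sqrt 4 :> R.
      by rewrite (_ : 4 = 2 ^+ 2) ?sqrtr_sqr ?ger0_norm //; lra.
    rewrite -sqrtrM // ler_sqrt; last by lra.
    have : j.+1%:R <= k.*2.+1%:R :> R by rewrite ler_nat.
    rewrite -[k.*2.+1]addn1 natrD -mul2n natrM.
    by lra.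
  apply: le_trans pw _.
  have : expR 1 * Num.sqrt j.+1%:R * a <= 4 * (2 * Num.sqrt (1 + lam)) * a.
    apply: ler_wpM2r => //; apply: ler_pM => //.
    lra.
  by lra.
exists k; split.
- have k0 : 0 <= k%:R :> R by [].
  have : (4%:R * k%:R) ^+ 2 <= (27 / 8 * lam) ^+ 2.
    by rewrite lerXn2r ?nnegrE ?mulr_ge0 // ?(le_trans k4) //; lra.
  by rewrite !exprMn; have := sqr_ge0 lam; lra.
- apply: (qle k); first by rewrite -addnn leq_addr.
  exact: pow_fact_ge.
- apply: (qle k.*2) => //.
  have -> : 4%:R ^+ k = 2%:R ^+ k.*2 :> R.
    by rewrite -mul2n exprM; congr (_ ^+ _); lra.
  apply: pow_fact_ge => //.
  by rewrite -mul2n natrM; lra.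
Qed.
End Factorials.

(** * Sums over primes *)

Section PrimeSums.

(** The two equal middle coefficients of row [2 m + 1] sum to at most
    [2 ^ (2 m + 1)]. *)
Lemma bin_middle_le m : ('C(m.*2.+1, m) <= 4 ^ m)%N.
Proof.
have : (\sum_(i < m.*2.+2) 'C(m.*2.+1, i) = 2 ^ m.*2.+1)%N.
  by rewrite -[2%N]/(1 + 1)%N expnDn; apply: eq_bigr => i _; rewrite !exp1n !muln1.
have lt1 : (m < m.*2.+2)%N by rewrite -addnn; lia.
have lt2 : (m.+1 < m.*2.+2)%N by rewrite -addnn; lia.
rewrite (bigD1 (Ordinal lt1)) //= (bigD1 (Ordinal lt2)) /=; last first.
  by rewrite -val_eqE /= gtn_eqF.
have -> : 'C(m.*2.+1, m.+1) = 'C(m.*2.+1, m).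
  by rewrite -bin_sub; [congr 'C(_, _)|]; rewrite -addnn; lia.
have -> : (2 ^ m.*2.+1 = 2 * 4 ^ m)%N by rewrite expnS -mul2n expnM.
lia.
Qed.

(** Every prime in [(m + 1, 2 m + 1]] divides the binomial coefficient
    ['C(2 m + 1, m)], whose size is known; the primes up to [m + 1] are
    handled by induction. *)
Lemma primorial_le n : (\prod_(0 <= p < n.+1 | prime p) p <= 4 ^ n)%N.
Proof.
elim/ltn_ind: n => n IH.
have [odd_n|even_n] := boolP (odd n); last first.
  case: n IH even_n => [|[|[|n]]] IH even_n //.
  - by rewrite unlock.
  - by rewrite unlock.
  have notp : prime n.+3 = false.
    by apply/negP => /even_prime[//|]; rewrite (negbTE even_n).
  rewrite big_mkcond big_nat_recr //= notp muln1 -big_mkcond.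
  by apply: leq_trans (IH n.+2 _) _; rewrite // leq_exp2l.
have nE : n = n./2.*2.+1 by rewrite -[LHS]odd_double_half odd_n.
move: nE; set m := n./2 => nE.
have [m0|m0] := posnP m; first by rewrite nE m0 unlock.
have mn : (m.+2 <= n.+1)%N by rewrite nE -addnn; lia.
rewrite (big_cat_nat _ mn) //=.
have -> : (4 ^ n = 4 ^ m.+1 * 4 ^ m)%N.
  by rewrite -expnD; congr expn; rewrite nE -addnn; lia.
apply: leq_mul; first by apply: IH; rewrite nE -addnn; lia.
apply: leq_trans (bin_middle_le m).
apply: dvdn_leq; first by rewrite bin_gt0 -addnn; lia.
rewrite -nE -big_filter.
rewrite (eq_bigr (fun p => (p ^ 1)%N)) => [|p _]; last by rewrite expn1.
apply: (@prod_prime_powers_dvd _ (fun=> 1%N)) => [|p|p].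
- by rewrite filter_uniq ?iota_uniq.
- by rewrite mem_filter => /andP[].
rewrite mem_filter mem_index_iota expn1 => /andP[pp /andP[mp pn]].
have mlen : (m <= n)%N by rewrite nE -addnn; lia.
have pf k : (k < p)%N -> ~~ (p %| k`!)%N.
  elim: k => [|k IHk] kp; first by rewrite fact0 dvdn1 neq_ltn prime_gt1 ?orbT.
  rewrite factS Euclid_dvdM // negb_or IHk ?(ltnW kp) // andbT.
  by apply/negP => /(dvdn_leq (ltn0Sn k)); lia.
have : (p %| 'C(n, m) * (m`! * (n - m)`!))%N.
  by rewrite bin_fact // dvdn_fact // prime_gt0.
rewrite !Euclid_dvdM // => /orP[//|/orP[]]; apply: contraLR => _; apply: pf.
  lia.
by rewrite nE -addnn in pn *; lia.
Qed.

Variable R : realType.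

Let lnn_ge0 m : 0 <= ln m%:R :> R.
Proof.
by case: m => [|m]; [rewrite ln0|rewrite ln_ge0 // ler1n].
Qed.

Lemma ln_prod_nat (s : seq nat) (P : pred nat) (F : nat -> nat) :
  (forall p, P p -> (0 < F p)%N) ->
  ln (\prod_(p <- s | P p) F p)%:R = \sum_(p <- s | P p) ln (F p)%:R :> R.
Proof.
move=> F0; suff [] : (0 < \prod_(p <- s | P p) F p)%N /\
  ln (\prod_(p <- s | P p) F p)%:R = \sum_(p <- s | P p) ln (F p)%:R :> R by [].
elim: s => [|p s [IH0 IH]]; first by rewrite !big_nil ln1.
rewrite !big_cons; case: ifP => // /F0 Fp; rewrite muln_gt0 Fp IH0; split => //.
by rewrite natrM lnM ?posrE ?ltr0n // IH.
Qed.

Lemma sum_ln_primes n :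
  \sum_(0 <= p < n.+1 | prime p) ln p%:R <= n%:R * ln 4 :> R.
Proof.
rewrite -(@ln_prod_nat _ prime id) => [|p]; last exact: prime_gt0.
rewrite mulr_natl -lnXn; last by lra.
have pos : (0 < \prod_(0 <= p < n.+1 | prime p) p)%N.
  by elim/big_ind: _ => // [x y x0 y0|p /prime_gt0 //]; rewrite muln_gt0 x0.
rewrite ler_ln ?posrE ?exprn_gt0 ?ltr0n //.
by rewrite -[4]/(4%:R) -natrX ler_nat primorial_le.
Qed.

(** Compare the exact contribution of the multiples of [p] to [n`!] with the
    trivial bound [n`! <= n ^ n]. *)
Lemma sum_ln_div_primes n : (0 < n)%N ->
  \sum_(0 <= p < n.+1 | prime p) ln p%:R / p%:R <= ln n%:R + ln 4 :> R.
Proof.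
move=> n0; have n0R : 0 < n%:R :> R by rewrite ltr0n.
rewrite -(ler_pM2l n0R) mulrDr mulr_sumr.
apply: (@le_trans _ _ (\sum_(0 <= p < n.+1 | prime p)
    ((n %/ p)%:R * ln p%:R + ln p%:R))).
  apply: ler_sum => p pp; rewrite -{3}[ln _]mul1r -mulrDl mulrA.
  rewrite mulrAC ler_wpM2r // ler_pdivrMr ?ltr0n ?prime_gt0 //.
  by rewrite -(natrD _ _ 1) -natrM ler_nat addn1 ltnW // ltn_ceil ?prime_gt0.
rewrite big_split /= lerD ?sum_ln_primes //.
have -> : \sum_(0 <= p < n.+1 | prime p) (n %/ p)%:R * ln p%:R =
    ln (\prod_(0 <= p < n.+1 | prime p) p ^ (n %/ p))%:R :> R.
  rewrite ln_prod_nat => [|p /prime_gt0 p0]; last by rewrite expn_gt0 p0.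
  apply: eq_bigr => p /prime_gt0 p0.
  by rewrite natrX lnXn ?ltr0n // mulr_natl.
rewrite mulr_natl -lnXn //.
have pos : (0 < \prod_(0 <= p < n.+1 | prime p) p ^ (n %/ p))%N.
  by elim/big_ind: _ => // [x y x0 y0|p /prime_gt0 p0]; rewrite ?muln_gt0 ?expn_gt0 ?x0 ?p0.
rewrite ler_ln ?posrE ?exprn_gt0 ?ltr0n // -natrX ler_nat.
apply: (@leq_trans n`!).
  apply: dvdn_leq; first exact: fact_gt0.
  rewrite -big_filter; apply: (prod_prime_powers_dvd (e := fun p => n %/ p)%N) => [|p|p].
  - by rewrite filter_uniq ?iota_uniq.
  - by rewrite mem_filter => /andP[].
  rewrite mem_filter => /andP[pp _].
  rewrite pfactor_dvdn ?fact_gt0 // logn_fact // big_nat_recl //= expn1.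
  exact: leq_addr.
rewrite -[X in (_ <= X ^ _)%N]/n fact_prod big_add1 /=.
rewrite -[X in (_ <= _ ^ X)%N](subn0 n) -prod_nat_const_nat big_nat [leqRHS]big_nat.
by apply: leq_prod => i /andP[].
Qed.

(** Partial summation, organised as an induction on [n = k.+2]: passing from [n]
    to [n.+1] the term of a new prime cancels on the left, and the change of
    denominator costs at most the increment of the right-hand side, because
    [1 - x <= - ln x] for [x = ln n / ln n.+1]. *)
Lemma sum_inv_primes_partial k :
  \sum_(0 <= p < k.+3 | prime p) p%:R^-1
  - (\sum_(0 <= p < k.+3 | prime p) ln p%:R / p%:R) / ln k.+2%:R
  <= ln (ln k.+2%:R) - ln (ln 2) + ln 4 * ((ln 2)^-1 - (ln k.+2%:R)^-1) :> R.
Proof.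
have lpos i : 0 < ln i.+2%:R :> R by rewrite ln_gt0 // ltr1n.
elim: k => [|k IH] /=.
  rewrite !subrr mulr0 addr0 unlock /=.
  have l2 := lpos 0; rewrite !addr0 mulrAC. rewrite mulfV ?mul1r ?subrr //.
  by rewrite gt_eqF.
set n := k.+2 in IH *.
have n1 : 0 < ln n%:R :> R by apply: lpos.
have n2 : 0 < ln n.+1%:R :> R by apply: lpos.
rewrite !(big_mkcond prime) !(big_nat_recr n.+1) //= -!(big_mkcond prime) /=.
set A := \sum_(_ <= p < _ | _) _ / _ in IH *.
set B := \sum_(_ <= p < _ | _) _ in IH *.
have -> : B + (if prime n.+1 then n.+1%:R^-1 else 0) -
   (A + (if prime n.+1 then ln n.+1%:R / n.+1%:R else 0)) / ln n.+1%:R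
   = B - A / ln n.+1%:R.
  case: ifP => _; last by rewrite !addr0.
  rewrite mulrDl [_ / n.+1%:R / _]mulrAC mulfV ?gt_eqF // mul1r.
  by ring.
have hA : A <= ln n%:R + ln 4 by apply: sum_ln_div_primes.
have mono : 0 <= (ln n%:R)^-1 - (ln n.+1%:R)^-1 :> R.
  by rewrite subr_ge0 lef_pV2 ?posrE // ler_ln ?posrE ?ltr0n // ler_nat.
have step : 1 - ln n%:R / ln n.+1%:R <= ln (ln n.+1%:R) - ln (ln n%:R) :> R.
  have q0 : 0 < ln n%:R / ln n.+1%:R :> R by rewrite divr_gt0.
  have := expR_ge1Dx (ln (ln n%:R / ln n.+1%:R) : R).
  by rewrite lnK ?posrE // ln_div ?posrE //; lra.
have := ler_wpM2r mono hA.
have -> : (ln n%:R + ln 4) * ((ln n%:R)^-1 - (ln n.+1%:R)^-1) =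
   1 - ln n%:R / ln n.+1%:R + ln 4 * ((ln n%:R)^-1 - (ln n.+1%:R)^-1) :> R.
  by rewrite mulrDl mulrBr mulfV ?gt_eqF.
lra.
Qed.

Lemma sum_inv_primes n : (1 < n)%N ->
  \sum_(0 <= p < n.+1 | prime p) p%:R^-1
  <= ln (ln n%:R) + (3 - ln (ln 2)) :> R.
Proof.
case: n => [|[|k]] // _; have := sum_inv_primes_partial k; rewrite /=.
have hA := @sum_ln_div_primes k.+2 isT.
have l0 : 0 < ln k.+2%:R :> R by rewrite ln_gt0 // ltr1n.
have l2 : 0 < ln 2 :> R by rewrite ln_gt0 // ltr1n.
have -> : ln 4 = 2 * ln 2 :> R.
  by rewrite (_ : 4 = 2 ^+ 2) ?lnXn ?mulr_natl //; lra.
have h : (\sum_(0 <= p < k.+3 | prime p) ln p%:R / p%:R) / ln k.+2%:R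
   <= 1 + ln 4 / ln k.+2%:R :> R.
  rewrite -[X in X + _](@mulfV _ (ln k.+2%:R)) ?gt_eqF // -mulrDl.
  by rewrite ler_wpM2r // invr_ge0 ltW.
have e4 : ln 4 = 2 * ln 2 :> R.
  by rewrite (_ : 4 = 2 ^+ 2) ?lnXn ?mulr_natl //; lra.
rewrite e4 in h.
have : 2 * ln 2 * ((ln 2)^-1 - (ln k.+2%:R)^-1) = 2 - 2 * ln 2 / ln k.+2%:R :> R.
  by rewrite mulrBr mulfK ?gt_eqF.
lra.
Qed.

Lemma ler_sum_sub_seq (s t : seq nat) (f : nat -> R) :
  uniq s -> {subset s <= t} -> uniq t -> (forall x, 0 <= f x) ->
  \sum_(x <- s) f x <= \sum_(x <- t) f x.
Proof.
move=> us st ut f0; rewrite [leRHS](bigID (mem s)) /=.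
have -> : \sum_(x <- t | x \in s) f x = \sum_(x <- s) f x.
  rewrite -big_filter; apply: perm_big; apply: uniq_perm => //.
    by rewrite filter_uniq.
  by move=> x; rewrite mem_filter; case: (boolP (x \in s)) => //= /st ->.
by rewrite lerDl sumr_ge0.
Qed.

(** Telescoping of [1 / (m (m - 1)) = 1 / (m - 1) - 1 / m]. *)
Lemma sum_inv_pronic (s : seq nat) a : (0 < a)%N -> uniq s ->
  (forall m, m \in s -> (a < m)%N) ->
  \sum_(m <- s) (m * m.-1)%:R^-1 <= a%:R^-1 :> R.
Proof.
move=> a0 us sa.
have tel k : \sum_(a.+1 <= m < (a + k).+1) (m * m.-1)%:R^-1
    = a%:R^-1 - (a + k)%:R^-1 :> R.
  elim: k => [|k IH]; first by rewrite addn0 big_geq // subrr.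
  rewrite addnS big_nat_recr ?ltnS ?leq_addr //= IH natrM -[(a + k).+1]addn1 natrD.
  have a0R : 0 < a%:R :> R by rewrite ltr0n.
  have k0R : 0 <= k%:R :> R by [].
  by field; apply/and3P; split; rewrite gt_eqF //; lra.
pose b := \max_(m <- s) m.
apply: (@le_trans _ _ (\sum_(a.+1 <= m < (a + b).+1) (m * m.-1)%:R^-1)).
  apply: ler_sum_sub_seq; rewrite ?iota_uniq // => m ms.
  rewrite mem_index_iota sa // ltnS; apply: leq_trans (leq_addl _ _).
  by rewrite /b (big_rem m) //= leq_maxl.
by rewrite tel gerBl.
Qed.

Lemma size_primes_le n : (0 < n)%N -> (2 ^ size (primes n) <= n)%N.
Proof.
move=> n0.
have h (s : seq nat) : (forall p, p \in s -> 1 < p)%N ->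
    (2 ^ size s <= \prod_(p <- s) p ^ 1)%N.
  elim: s => [|p s IH] s1; first by rewrite big_nil.
  rewrite big_cons (expnS 2) expn1 leq_mul ?s1 ?mem_head //.
  by apply: IH => q qs; rewrite s1 // inE qs orbT.
have pr p : p \in primes n -> prime p by rewrite mem_primes => /andP[].
apply: leq_trans (h _ (fun p pn => prime_gt1 (pr p pn))) _.
apply: dvdn_leq => //; apply: (@prod_prime_powers_dvd _ (fun=> 1%N)) => //.
- exact: primes_uniq.
- by move=> p; rewrite mem_primes expn1 => /and3P[].
Qed.

(** Prime divisors of [n] above [ln n] are too few and too large to matter. *)
Lemma sum_inv_prime_divisors n : 3 <= ln n%:R :> R ->
  \sum_(p <- primes n) p%:R^-1 <= ln (ln (ln n%:R)) + (3 - ln (ln 2) + (ln 2)^-1) :> R.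
Proof.
move=> ln3.
have n0 : (0 < n)%N by case: n ln3 => // ; rewrite ln0 //; lra.
set L := ln n%:R in ln3 *.
have L0 : 0 <= L by lra.
pose N := Num.truncn L.
have /andP[NL LN] := truncn_itv L0; rewrite -/N in NL LN.
have N2 : (1 < N)%N by rewrite -ltnS -(ltr_nat R); apply: le_lt_trans LN; lra.
have l2 : 0 < ln 2 :> R by rewrite ln_gt0 // ltr1n.
rewrite (bigID (fun p => p <= N)%N) /= addrA lerD //.
  apply: le_trans (le_trans (sum_inv_primes N2) _); last first.
    rewrite lerD2r ler_ln ?posrE ?ln_gt0 ?ltr1n //; last by lra.
    by rewrite ler_ln ?posrE ?ltr0n //; [lia|lra].
  rewrite -[leRHS]big_filter -big_filter.
  apply: ler_sum_sub_seq; rewrite ?filter_uniq ?primes_uniq ?iota_uniq //.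
  move=> p; rewrite !mem_filter mem_index_iota mem_primes /= => /andP[pN /andP[-> _]].
  by rewrite ltnS.
apply: (@le_trans _ _ (\sum_(p <- primes n | ~~ (p <= N)%N) L^-1)).
  apply: ler_sum => p; rewrite -ltnNge => Np.
  rewrite lef_pV2 ?posrE ?ltr0n; [|lia|lra].
  by apply: le_trans (ltW LN) _; rewrite ler_nat.
rewrite big_const_seq iter_addr_0 -[L^-1 *+ _]mulr_natr mulrC ler_pdivrMr; last by lra.
rewrite mulrC ler_pdivlMr // mulr_natl -lnXn //.
rewrite /L ler_ln ?posrE ?exprn_gt0 ?ltr0n //.
rewrite -[2]/(2%:R) -natrX ler_nat.
by apply: leq_trans (size_primes_le n0); rewrite leq_exp2l // count_size.
Qed.

(** Each factor of [totient n / n] satisfies [1 - 1 / p >= expR (- 1 / (p - 1))],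
    and [1 / (p - 1) = 1 / p + 1 / (p (p - 1))] where the last terms sum to at
    most [1]. *)
Lemma totient_ge n : (0 < n)%N ->
  n%:R * expR (- (\sum_(p <- primes n) p%:R^-1 + 1)) <= (totient n)%:R :> R.
Proof.
move=> n0.
have pr p : p \in primes n -> prime p by rewrite mem_primes => /andP[].
have -> : n%:R = \prod_(p <- primes n) (p ^ logn p n)%:R :> R.
  rewrite -natr_prod {1}(prod_prime_decomp n0) prime_decompE big_map /=.
  by [].
rewrite totientE // natr_prod.
apply: (@le_trans _ _ ((\prod_(p <- primes n) (p ^ logn p n)%:R) *
     expR (- \sum_(p <- primes n) p.-1%:R^-1))).
  rewrite ler_wpM2l ?prodr_ge0 // ler_expR lerN2.
  have := @sum_inv_pronic (primes n) 1 isT (primes_uniq n).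
  rewrite invr1 => /(_ (fun m mp => prime_gt1 (pr m mp))).
  rewrite -(lerD2l (\sum_(p <- primes n) p%:R^-1)) -big_split /=; apply: le_trans.
  rewrite big_seq [leRHS]big_seq; apply: ler_sum => p /pr pp.
  have p1 := prime_gt1 pp.
  have p10 : 0 < p.-1%:R :> R by rewrite ltr0n; lia.
  have pE : p%:R = p.-1%:R + 1 :> R by rewrite natr1 prednK // prime_gt0.
  rewrite natrM pE le_eqVlt; apply/orP; left; apply/eqP; field.
  by apply/andP; split; rewrite gt_eqF //; lra.
rewrite -sumrN expR_sum -big_split /= big_seq [leRHS]big_seq.
apply: ler_prod => p pn; have pp := pr p pn; rewrite mulr_ge0 ?expR_ge0 //=.
have p1 := prime_gt1 pp.
have [l lE] : exists l, logn p n = l.+1.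
  by exists (logn p n).-1; rewrite prednK // logn_gt0.
have pE : p%:R = p.-1%:R + 1 :> R by rewrite natr1 prednK // prime_gt0.
rewrite lE /= expnS !natrM mulrAC ler_wpM2r // pE.
have : 0 < p.-1%:R :> R by rewrite ltr0n; lia.
move: (p.-1%:R : R) => x x0; rewrite expRN ler_pdivrMr ?expR_gt0 //.
apply: le_trans (ler_wpM2l (ltW x0) (expR_ge1Dx _)).
by rewrite mulrDr mulfV ?gt_eqF // mulr1.
Qed.
End PrimeSums.

(** * The density bound *)

Section Main.
Variable R : realType.

Lemma odd_prime_sum_le n : (1 < n)%N ->
  \sum_(p <- primes n) p%:R^-1 <=
  \sum_(p <- primes n | odd p) p%:R^-1 + 1 / 2 :> R.
Proof.
move=> n1; rewrite (bigID odd) /= lerD2l -big_filter.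
apply: (@le_trans _ _ (\sum_(p <- [:: 2%N]) p%:R^-1)); last first.
  by rewrite big_seq1 div1r.
apply: ler_sum_sub_seq; rewrite ?filter_uniq ?primes_uniq //.
move=> p; rewrite mem_filter mem_primes inE => /andP[po /andP[pp _]].
by case/even_prime: pp po => [->|->].
Qed.

(** [poisson_choice] gives the mass [q / 12] of missing shares, and
    [totient n / n] the factor [expR (- lam)] up to a constant. *)
Lemma sum_product_free_density n (A : {set 'Z_n}) (lam : R) : (1 < n)%N ->
  lam = \sum_(p <- primes n | odd p) p%:R^-1 ->
  sum_free A -> product_free A -> (5 * n < 11 * #|A|)%N ->
  density R A <= 1 / 2 - expR (- (1 - poisson_exponent R) * lam - 3 / 2)
                         / (384 * Num.sqrt (1 + lam)).
Proof.
move=> n1 lam_def sfA pfA denseA.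
have n0 : (0 < n)%N by apply: ltnW.
have n0R : 0 < n%:R :> R by rewrite ltr0n.
have [n_even oddA] := dense_sum_free_odd n1 sfA denseA.
pose P := [seq p <- primes n | odd p].
have PP p : p \in P -> [/\ prime p, odd p & p %| n]%N.
  by rewrite mem_filter mem_primes => /and3P[-> -> /andP[_ ->]].
have uP : uniq P by rewrite filter_uniq ?primes_uniq.
pose pr (i : 'I_(size P)) := tnth (in_tuple P) i.
have prP i : pr i \in P by apply: mem_tnth.
have prsum (F : nat -> R) : \sum_i F (pr i) = \sum_(p <- primes n | odd p) F p.
  by rewrite -[RHS]big_filter (big_tnth _ _ P).
have prI : injective pr by apply/tuple_uniqP.
have lam0 : 0 <= lam by rewrite lam_def sumr_ge0.
have [pr1 pr2 pr3] : [/\ forall i, prime (pr i), forall i, odd (pr i)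
    & forall i, (pr i %| n)%N].
  by split=> i; have [] := PP _ (prP i).
pose w i : R := (pr i)%:R^-1.
pose al := missing_share R A pr.
have w0 i : 0 <= w i by rewrite invr_ge0.
have lamE : \sum_i w i = lam by rewrite lam_def; apply: (prsum (fun p => p%:R^-1)).
have sqw : \sum_i w i ^+ 2 <= 1 / 2.
  rewrite (prsum (fun p => p%:R^-1 ^+ 2)) -big_filter.
  apply: le_trans (_ : \sum_(p <- P) (p * p.-1)%:R^-1 <= _); last first.
    rewrite div1r; apply: (@sum_inv_pronic R P 2) => // p /PP[pp po _].
    by apply: odd_prime_gt2.
  rewrite big_seq [leRHS]big_seq; apply: ler_sum => p /PP[/prime_gt1 p1 _ _].
  rewrite exprVn lef_pV2 ?posrE ?exprn_gt0 ?ltr0n ?muln_gt0; try lia.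
  by rewrite -natrX ler_nat -mulnn leq_mul2l leq_pred orbT.
have mass := missing_mass R n1 n_even oddA pr1 pr2 pr3 prI.
set M := \sum_I _ in mass.
have [k [k1 k2 k3]] := poisson_choice lam0.
set q := expR (_ * lam) / _ in k2 k3.
have q0 : 0 < q by rewrite divr_gt0 ?expR_gt0 // mulr_gt0 // sqrtr_gt0; lra.
have qM : q <= 12 * M.
  have al0 I : 0 <= al I by apply: missing_share_ge0.
  have ald := @missing_share_disjoint R n A n1 pfA _ pr.
  by apply: (averaging_poisson w0 al0 ald sqw (k := k)); rewrite ?lamE.
have tot : n%:R * expR (- lam - 3 / 2) <= (totient n)%:R :> R.
  apply: le_trans (totient_ge R n0); rewrite ler_wpM2l // ler_expR.
  by have := odd_prime_sum_le n1; rewrite -lam_def; lra.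
have M0 : 0 <= M by lra.
have gap : expR (- (1 - poisson_exponent R) * lam - 3 / 2)
    / (384 * Num.sqrt (1 + lam)) = expR (- lam - 3 / 2) * (q / 12).
  rewrite /q (_ : _ * lam - 3 / 2 = (- lam - 3 / 2) + poisson_exponent R * lam).
    by rewrite expRD; field; rewrite gt_eqF // sqrtr_gt0; lra.
  by lra.
rewrite gap /density ler_pdivrMr //.
have : n%:R * (expR (- lam - 3 / 2) * (q / 12)) <= (totient n)%:R * M.
  rewrite mulrA ler_pM ?mulr_ge0 ?expR_ge0 //; lra.
lra.
Qed.

End Main.

Theorem theorem1p2 (R : realType) :
  exists2 kappa : R, 0 < kappa &
    exists N : nat, forall n : nat, (1 < n)%N -> (N <= n)%N ->
      Dprime R n <=
        1 / 2 - kappa / (ln (ln n%:R) `^ (1 - expR 1 / 2 * ln 2)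
                         * ln (ln (ln n%:R)) `^ (1 / 2)).
Proof.
(* [C] bounds [lam - ln (ln (ln n))]. *)
pose C : R := 3 - ln (ln 2) + (ln 2)^-1.
have l2 : 0 < ln 2 :> R by rewrite ln_gt0 // ltr1n.
have l2' : ln 2 <= 1 :> R by have := @le_ln1Dx R 1; rewrite -[1 + 1]/2; apply; lra.
have C0 : 0 <= C.
  have : ln (ln 2) <= 0 :> R by apply: ln_le0.
  have : 0 < (ln 2)^-1 :> R by rewrite invr_gt0.
  by rewrite /C; lra.
have s2 : 1 <= Num.sqrt (2 + C) by rewrite -[leLHS]sqrtr1 ler_sqrt; lra.
pose kappa := expR (- C - 3 / 2) / (384 * Num.sqrt (2 + C)).
have kappa0 : 0 < kappa by rewrite divr_gt0 ?expR_gt0 //; lra.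
have kappa_le : kappa <= 1 / 22.
  have : expR (- C - 3 / 2) <= 1 :> R by rewrite expR_le1; lra.
  by rewrite ler_pdivrMr; lra.
exists kappa => //.
(* This threshold makes [ln (ln (ln n)) >= 1]. *)
exists (Num.truncn (expR (expR (expR 1)) : R)).+1 => n n1 nN.
have n0R : 0 < n%:R :> R by rewrite ltr0n ltnW.
pose L1 : R := ln n%:R; pose L2 := ln L1; pose L3 := ln L2.
have e2 : 2 <= expR 1 :> R by apply: le_trans (expR_ge1Dx _); lra.
have h1 : expR (expR 1) <= L1.
  rewrite -ler_expR lnK ?posrE //; apply: le_trans (ltW (truncnS_gt _)) _.
  by rewrite ler_nat.
have L1_3 : 3 <= L1.
  by apply: le_trans h1; apply: le_trans (expR_ge1Dx _); lra.
have h2 : expR 1 <= L2 by rewrite -ler_expR lnK ?posrE //; lra.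
have h3 : 1 <= L3 by rewrite -ler_expR lnK ?posrE //; lra.
rewrite -/L1 -/L2 -/L3 -/(poisson_exponent R).
set b := poisson_exponent R.
have b1 : b <= 1 := poisson_exponent_le1 R.
have -> : L2 `^ (1 - b) = expR ((1 - b) * L3).
  by rewrite mulrC expRM lnK ?posrE //; lra.
rewrite div1r powR12_sqrt; last by lra.
have s3 : 1 <= Num.sqrt L3 by rewrite -[leLHS]sqrtr1 ler_sqrt; lra.
have e3 : 1 <= expR ((1 - b) * L3).
  by rewrite -[leLHS]expR0 ler_expR; apply: mulr_ge0; lra.
have den1 : 1 <= expR ((1 - b) * L3) * Num.sqrt L3.
  by rewrite -[leLHS]mulr1 ler_pM.
(* [1 / 22 = 1 / 2 - 5 / 11] is the gap for sets that are not dense. *)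
have small : kappa / (expR ((1 - b) * L3) * Num.sqrt L3) <= 1 / 22.
  rewrite ler_pdivrMr; last by lra.
  by apply: le_trans kappa_le _; lra.
apply: bigmax_le => [|A /andP[sfA pfA]]; first by lra.
have [denseA|] := ltnP (5 * n) (11 * #|A|); last first.
  move=> sparse; apply: (@le_trans _ _ (1 / 2 - 1 / 22)); last by lra.
  rewrite /density ler_pdivrMr //.
  by move: sparse; rewrite -(ler_nat R) !natrM; lra.
apply: le_trans (sum_product_free_density n1 (erefl _) sfA pfA denseA) _.
set lam := \sum_(_ <- _ | _) _.
have lam0 : 0 <= lam by apply: sumr_ge0.
have lamC : lam <= L3 + C.
  apply: le_trans (sum_inv_prime_divisors L1_3).
  by rewrite [leRHS](bigID odd) /= lerDl sumr_ge0.
rewrite div1r lerD2l lerN2 -/b.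
rewrite ler_pdivrMr; last by lra.
have sq1 : Num.sqrt (1 + lam) <= Num.sqrt (2 + C) * Num.sqrt L3.
  rewrite -sqrtrM; last by lra.
  rewrite ler_sqrt; last by apply: mulr_ge0; lra.
  have : C * 1 <= C * L3 by rewrite ler_wpM2l.
  lra.
have sq0 : 0 < Num.sqrt (1 + lam) by rewrite sqrtr_gt0; lra.
have ex : expR (- C - 3 / 2) <=
    expR (- (1 - b) * lam - 3 / 2) * expR ((1 - b) * L3).
  rewrite -expRD ler_expR.
  have : (1 - b) * lam <= (1 - b) * (L3 + C) by rewrite ler_wpM2l //; lra.
  have : 0 <= b * C.
    by rewrite mulr_ge0 // /b /poisson_exponent !mulr_ge0 ?expR_ge0 ?invr_ge0 // ltW.
  lra.
rewrite /kappa ler_pdivrMr; last by lra.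
set E := expR (- (1 - b) * _ - _) in ex *.
have E0 : 0 <= E by apply: expR_ge0.
apply: le_trans ex _.
have -> : E / (384 * Num.sqrt (1 + lam)) * (expR ((1 - b) * L3) * Num.sqrt L3)
     * (384 * Num.sqrt (2 + C)) =
   E * expR ((1 - b) * L3) * ((Num.sqrt (2 + C) * Num.sqrt L3) / Num.sqrt (1 + lam)).
  by field; rewrite gt_eqF.
rewrite ler_peMr ?mulr_ge0 ?expR_ge0 //.
by rewrite ler_pdivlMr // mul1r.
Qed.
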